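(* If a finitely generated group $G$ satisfies the Ciobanu–Holt–Rees (CHR) property, then $G$ satisfies the centroid property.
   Context: All polynomials are assumed to have non-negative coefficients. CHR property: let $G$ be a finitely generated group with word length function $L$ (with respect to some finite generating set). A pair $(x,y)\in G\times G$ is a factorisation of $g\in G$ if $g=xy$ and $L(x)+L(y)=L(g)$. Let $\mathcal{D}$ be a subset of the set of all factorisations of elements of $G$. Let $S(r)$ be the set of elements of $G$ of length $r$. For $g\in S(r+r')$ let $\mathcal{F}_{g,r,r'}$ be the number of factorisations $(x,y)\in\mathcal{D}$ of $g$ with $L(x)=r$, $L(y)=r'$, and let $\mathcal{F}_{\mathcal{D},r,r'}=\sup_{g\in S(r+r')}\mathcal{F}_{g,r,r'}$. $G$ satisfies the CHR property if, for some such $\mathcal{D}$: (D1) $\mathcal{F}_{\mathcal{D},r,r'}\le P_1(\min(r,r'))$ for some polynomial $P_1$ and all $r,r'$; (D2) for each $k\in G$ and all $r,r'\ge 0$ there is a subset $U(k,r,r')\subseteq G\times G\times G$ such that for each representation $k=g_1g_2$ with $g_1\in S(r)$, $g_2\in S(r')$, the set $U(k,r,r')$ contains a triple $(f_1,\hat k,f_2)$ with $k=f_1\hat k f_2$ and $\hat k=h_1h_2$, where $(f_1,h_1)\in\mathcal{D}$, $L(f_1)+L(h_1)=r$, $f_1h_1=g_1$, and $(h_2,f_2)\in\mathcal{D}$, $L(h_2)+L(f_2)=r'$, $h_2f_2=g_2$, and $L(h_1),L(h_2)\le K\min(r,r')$ for some uniform constant $K$. Furthermore there are polynomials $P_2,P_3$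 such that (a) $|U(k,r,r')|\le P_2(\min(r,r'))$ for all $k,r,r'$; (b) $|T(r,r')|\le P_3(\min(r,r'))$ for all $r,r'$, where $T(r,r')=\{\hat k : \text{there are } k,f_1,f_2\in G \text{ with } (f_1,\hat k,f_2)\in U(k,r,r')\}$. Centroid property: a countable group $G$ satisfies the centroid property if there exist an action of $G$ by isometries on a metric space $(X,\mathrm{dist})$ with point stabilizers finite of uniformly bounded sizes, a point $x_0\in X$, a map $\mathfrak{c}\colon G\times G\to X$ and a polynomial $P$ such that, with $L(g)=\mathrm{dist}(x_0,g\cdot x_0)$: ($c_1$) for every $k\in G$ and every $r>0$, the set $\{\mathfrak{c}(g,k): g\in G,\ L(g)\le r\}$ has at most $P(r)$ elements; ($c_2$) for every $g\in G$, the set $\{\mathfrak{c}(g,k): k\in G\}$ has at most $P(L(g))$ elements; ($c_3$) for every $h\in G$ and every $r>0$, the set $\{g^{-1}\cdot\mathfrak{c}(g,gh): g\in G,\ L(g)\le r\}$ has at most $P(r)$ elements. *)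

(* Defs.v *)
From HB Require Import structures.
From mathcomp Require Import all_boot all_order all_algebra.
From mathcomp Require Import all_classical all_reals all_analysis.

Set Implicit Arguments.
Unset Strict Implicit.
Unset Printing Implicit Defensive.

Import Order.TTheory GRing.Theory Num.Theory.

Local Open Scope classical_set_scope.
Local Open Scope ring_scope.

(* [counting] is +oo on infinite sets, so the bound asserts that A is finite. *)
Definition card_le_real (R : realType) (T : choiceType) (A : set T) (x : R) :
  Prop := (counting A <= x%:E)%E.

Definition nonneg_poly (R : realType) (P : {poly R}) : Prop :=
  P \is a polyOver Num.nneg.

Section WordLength.
Variables (G : groupType) (A : set G).

Definition is_word (s : seq G) : Prop :=
  forall a, a \in s -> A a \/ A (a^-1)%g.

Definition represented_in (g : G) (n : nat) : Prop :=
  exists s : seq G, [/\ is_word s, size s = n & (\prod_(a <- s) a)%g = g].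

Definition generates : Prop := forall g : G, exists n, represented_in g n.

Lemma represented_inW (g : G) :
  (exists n, represented_in g n) -> exists n, `[< represented_in g n >].
Proof. by move=> [n gn]; exists n; apply/asboolP. Qed.

(* The least length of a word representing g; the junk value 0 is never taken
   when A generates G. *)
Definition word_length (g : G) : nat :=
  match pselect (exists n, represented_in g n) with
  | left e => ex_minn (represented_inW e)
  | right _ => 0%N
  end.

End WordLength.

Definition finite_generating_set (G : groupType) (A : set G) : Prop :=
  finite_set A /\ generates A.

Definition finitely_generated (G : groupType) : Prop :=
  exists A : set G, finite_generating_set A.

Section CHR.
Variables (R : realType) (G : groupType) (L : G -> nat).

Definition sphere (r : nat) : set G := [set g | L g = r].

Definition factorisations : set (G * G) :=
  [set p | (L p.1 + L p.2)%N = L (p.1 * p.2)%g].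

Definition factorisation_number (D : set (G * G)) (g : G) (r r' : nat) :
    \bar R :=
  counting [set p | [/\ D p, (p.1 * p.2)%g = g, L p.1 = r & L p.2 = r']].

Definition sup_factorisation_number (D : set (G * G)) (r r' : nat) : \bar R :=
  ereal_sup [set factorisation_number D g r r' | g in sphere (r + r')%N].

Definition CHR_D1 (D : set (G * G)) : Prop :=
  exists P1 : {poly R}, nonneg_poly P1 /\
    forall r r' : nat,
      (sup_factorisation_number D r r' <= (P1.[(minn r r')%:R])%:E)%E.

(* (f1, k', f2) is an admissible triple for k = g1 g2, with g1 and g2 of
   lengths r and r'; k' is the element written "k hat". *)
Definition CHR_triple (D : set (G * G)) (K : R) (k g1 g2 : G) (r r' : nat)
    (f1 k' f2 : G) : Prop :=
  k = (f1 * k' * f2)%g /\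
  exists h1 h2 : G,
    [/\ k' = (h1 * h2)%g,
        [/\ D (f1, h1), (L f1 + L h1)%N = r & (f1 * h1)%g = g1],
        [/\ D (h2, f2), (L h2 + L f2)%N = r' & (h2 * f2)%g = g2],
        (L h1)%:R <= K * (minn r r')%:R
      & (L h2)%:R <= K * (minn r r')%:R].

Definition CHR_T (U : G -> nat -> nat -> set (G * G * G)) (r r' : nat) :
    set G :=
  [set k' | exists k f1 f2 : G, U k r r' (f1, k', f2)].

Definition CHR_D2 (D : set (G * G)) : Prop :=
  exists (U : G -> nat -> nat -> set (G * G * G)) (K : R),
  [/\ forall (k : G) (r r' : nat) (g1 g2 : G),
        sphere r g1 -> sphere r' g2 -> k = (g1 * g2)%g ->
        exists f1 k' f2 : G,
          U k r r' (f1, k', f2) /\ CHR_triple D K k g1 g2 r r' f1 k' f2,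
      exists P2 : {poly R}, nonneg_poly P2 /\
        forall (k : G) (r r' : nat),
          card_le_real (U k r r') P2.[(minn r r')%:R]
    & exists P3 : {poly R}, nonneg_poly P3 /\
        forall r r' : nat,
          card_le_real (CHR_T U r r') P3.[(minn r r')%:R]].

Definition CHR_for_length : Prop :=
  exists D : set (G * G), [/\ D `<=` factorisations, CHR_D1 D & CHR_D2 D].

End CHR.

(* The word length is taken with respect to some finite generating set. *)
Definition CHR_property (R : realType) (G : groupType) : Prop :=
  exists A : set G, finite_generating_set A /\ CHR_for_length R (word_length A).

Section Centroid.
Variables (R : realType) (G : groupType) (X : metricType R).

Definition isometric_action (act : G -> X -> X) : Prop :=
  [/\ forall x, act 1%g x = x,
      forall g h x, act (g * h)%g x = act g (act h x)
    & forall g x y, mdist (act g x) (act g y) = mdist x y].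

Definition bounded_stabilisers (act : G -> X -> X) : Prop :=
  exists N : nat, forall x : X,
    card_le_real [set g | act g x = x] (N%:R : R).

Definition orbit_length (act : G -> X -> X) (x0 : X) (g : G) : R :=
  mdist x0 (act g x0).

Definition centroid_map (act : G -> X -> X) (x0 : X) (c : G -> G -> X)
    (P : {poly R}) : Prop :=
  let L := orbit_length act x0 in
  [/\ forall (k : G) (r : R), 0 < r ->
        card_le_real [set c g k | g in [set g | L g <= r]] P.[r],
      forall g : G,
        card_le_real [set c g k | k in [set: G]] P.[L g]
    & forall (h : G) (r : R), 0 < r ->
        card_le_real [set act (g^-1)%g (c g (g * h)%g) | g in [set g | L g <= r]]
          P.[r]].

End Centroid.

Definition centroid_property (R : realType) (G : groupType) : Prop :=
  countable [set: G] /\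
  exists (X : metricType R) (act : G -> X -> X) (x0 : X) (c : G -> G -> X)
         (P : {poly R}),
    [/\ isometric_action act, bounded_stabilisers act, nonneg_poly P
      & centroid_map act x0 c P].

(* Main.v *)
Require Import Defs.
From HB Require Import structures.
From mathcomp Require Import all_boot all_order all_algebra.
From mathcomp Require Import all_classical all_reals all_analysis.
From mathcomp Require Import zify.

Set Implicit Arguments.
Unset Strict Implicit.
Unset Printing Implicit Defensive.

Import Order.TTheory GRing.Theory Num.Theory.

Local Open Scope classical_set_scope.
Local Open Scope ring_scope.

(** The space X is G itself with the word metric, on which G acts freely by
left translation, with base point 1; the orbit length is then the word length
L.  For the centroid of g and k, write k = g (g^-1 k) and apply condition (D2)
to this factorisation: it cuts g = f1 h1 and g^-1 k = h2 f2, so that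
k = f1 (h1 h2) f2 with the middle part h1 h2 drawn from a small set.  Put
c(g, k) = f1, a point on a geodesic from 1 to g.  The three counts are as
follows.

- k fixed, L g <= n: f1 is the first entry of a triple in
  U(k, L g, L (g^-1 k)).  Since |L k - L (g^-1 k)| <= L g <= n, there are
  polynomially many pairs of lengths, and (D2)(a) bounds each of these sets
  ([card_centroids_left]).
- g fixed: f1 is a left factor of g in D, and (D1) bounds the number of these
  for each of the L g + 1 possible lengths ([card_centroids_right]).
- h fixed, k = g h, L g <= n: g^-1 f1 = h1^-1 = h2 (h1 h2)^-1.  Here h2 is a
  left factor of h in D of length at most K n, so (D1) applies again, and
  h1 h2 belongs to one of n + 1 sets T(i, L h), to which (D2)(b) applies
  ([card_centroids_translated]).

The first and third counts work because all the bounds given by the CHR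
property depend on min(r, r') only, and here this is at most L g <= n even
when the other length is unbounded. *)

(** * Finite sets of bounded cardinality *)

Section BoundedCardinality.
Variables (R : realType).
Implicit Types (T : choiceType) (x y : R).

(** Lists with repetitions are allowed on the right, so that images, unions and
products reduce to mapping, concatenating and pairing lists, without any
disjointness or injectivity to check. *)
Lemma card_le_realP T (B : set T) x :
  card_le_real B x <-> exists2 s : seq T, B `<=` [set` s] & (size s)%:R <= x.
Proof.
rewrite /card_le_real /counting; split.
  case: asboolP => [finB|_]; last by rewrite leye_eq.
  rewrite lee_fin => leBx; exists (finmap.enum_fset (fset_set B)) => //.
  by move=> t Bt; rewrite /= in_fset_set // inE.
move=> [s sB les].
have finB : finite_set B by apply: sub_finite_set sB _.
rewrite asboolT // lee_fin; apply: le_trans les; rewrite ler_nat.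
apply: uniq_leq_size; first exact: finmap.fset_uniq.
by move=> t; rewrite in_fset_set // inE => /sB.
Qed.

Lemma card_le_real_sub T (B C : set T) x :
  B `<=` C -> card_le_real C x -> card_le_real B x.
Proof.
move=> BC /card_le_realP[s Cs ?]; apply/card_le_realP; exists s => //.
exact: subset_trans Cs.
Qed.

Lemma card_le_real_le T (B : set T) x y :
  x <= y -> card_le_real B x -> card_le_real B y.
Proof. by move=> xy Bx; apply: le_trans Bx _; rewrite lee_fin. Qed.

Lemma card_le_real0 T x : 0 <= x -> card_le_real (@set0 T) x.
Proof. by move=> x0; apply/card_le_realP; exists [::]. Qed.

Lemma card_le_real_image T T' (f : T -> T') (B : set T) x :
  card_le_real B x -> card_le_real (f @` B) x.
Proof.
move=> /card_le_realP[s Bs lesx]; apply/card_le_realP.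
exists (map f s); last by rewrite size_map.
by move=> _ [t /Bs ts <-]; exact: map_f.
Qed.

Lemma card_le_real_image2 T T' T'' (f : T -> T' -> T'') (B : set T)
    (C : set T') x y :
  card_le_real B x -> card_le_real C y ->
  card_le_real [set f b c | b in B & c in C] (x * y).
Proof.
move=> /card_le_realP[s Bs lesx] /card_le_realP[s' Cs' les'y].
apply/card_le_realP; exists [seq f b c | b <- s, c <- s'].
  by move=> _ [b /Bs bs [c /Cs' cs' <-]]; exact: allpairs_f.
by rewrite size_allpairs natrM ler_pM.
Qed.

Lemma card_le_real_bigcup T n (F : nat -> set T) x :
  (forall i, (i < n)%N -> card_le_real (F i) x) ->
  card_le_real (\bigcup_(i < n) F i) (n%:R * x).
Proof.
elim: n => [|n IHn] Fx.
  by rewrite II0 bigcup_set0 mul0r; exact: card_le_real0.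
have /card_le_realP[s Fs lesx] : card_le_real (\bigcup_(i < n) F i) (n%:R * x).
  by apply: IHn => i /ltnW; exact: Fx.
have /card_le_realP[s' Fs' les'x] := Fx n (ltnSn n).
apply/card_le_realP; exists (s ++ s').
  move=> t [i /=]; rewrite ltnS leq_eqVlt => /orP[/eqP -> /Fs'|ltin Fit] /=.
    by rewrite mem_cat => ->; rewrite orbT.
  by rewrite mem_cat Fs //; exists i.
by rewrite size_cat natrD -natr1 mulrDl mul1r lerD.
Qed.

End BoundedCardinality.

(** * Polynomials with nonnegative coefficients *)

Section NonnegPoly.
Variable R : realType.
Implicit Types (P Q : {poly R}) (x y : R).

Lemma nonneg_polyP P : nonneg_poly P <-> forall i, 0 <= P`_i.
Proof.
split=> [/polyOverP P0 i|P0]; first by rewrite -nnegrE P0.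
by apply/polyOverP => i; rewrite nnegrE.
Qed.

Lemma nonneg_poly_ge0 P x : nonneg_poly P -> 0 <= x -> 0 <= P.[x].
Proof.
move=> /nonneg_polyP P0 x0; rewrite horner_coef sumr_ge0 // => i _.
by rewrite mulr_ge0 ?exprn_ge0.
Qed.

Lemma nonneg_poly_le P x y : nonneg_poly P -> 0 <= x -> x <= y -> P.[x] <= P.[y].
Proof.
move=> /nonneg_polyP P0 x0 xy; rewrite !horner_coef ler_sum // => i _.
by rewrite ler_wpM2l ?lerXn2r // nnegrE (le_trans x0).
Qed.

Lemma nonneg_polyD P Q : nonneg_poly P -> nonneg_poly Q -> nonneg_poly (P + Q).
Proof.
move=> /nonneg_polyP P0 /nonneg_polyP Q0; apply/nonneg_polyP => i.
by rewrite coefD addr_ge0.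
Qed.

Lemma nonneg_polyM P Q : nonneg_poly P -> nonneg_poly Q -> nonneg_poly (P * Q).
Proof.
move=> /nonneg_polyP P0 /nonneg_polyP Q0; apply/nonneg_polyP => i.
by rewrite coefM sumr_ge0 // => j _; rewrite mulr_ge0.
Qed.

Lemma nonneg_poly_comp P Q :
  nonneg_poly P -> nonneg_poly Q -> nonneg_poly (P \Po Q).
Proof. exact: polyOver_comp. Qed.

Lemma nonneg_polyX : nonneg_poly ('X : {poly R}).
Proof. exact: polyOverX. Qed.

Lemma nonneg_polyC x : 0 <= x -> nonneg_poly x%:P.
Proof. by move=> x0; apply/nonneg_polyP => i; rewrite coefC; case: ifP. Qed.

End NonnegPoly.

(** * Length functions and word length *)

(** What word length contributes to the argument: these properties make
(g, h) |-> L (g^-1 h) a left-invariant metric, and they bound L (g^-1 k) by L g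
and L k. *)
Definition length_function (G : groupType) (L : G -> nat) : Prop :=
  [/\ forall g, L g = 0%N <-> g = 1%g,
      forall g, L (g^-1)%g = L g
    & forall g h, (L (g * h)%g <= L g + L h)%N].

Section WordLengthTheory.
Variables (G : groupType) (A : set G).

Lemma word_length_le (g : G) n :
  represented_in A g n -> (word_length A g <= n)%N.
Proof.
rewrite /word_length => gn; case: pselect => // e.
by case: ex_minnP => m _; apply; apply/asboolP.
Qed.

(** Generators may be used inverted, so words can be read backwards; this is
what makes word length, hence the word metric, symmetric. *)
Lemma is_wordV (s : seq G) :
  is_word A s -> is_word A [seq a^-1%g | a <- rev s].
Proof.
by move=> sA _ /mapP[a + ->]; rewrite mem_rev invgK => /sA[]; [right|left].
Qed.

Lemma represented_inV (g : G) n :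
  represented_in A g n -> represented_in A (g^-1)%g n.
Proof.
move=> [s [sA <- <-]]; exists [seq a^-1%g | a <- rev s]; split.
- exact: is_wordV.
- by rewrite size_map size_rev.
- by rewrite big_map prodgV revK.
Qed.

Lemma represented_inM (g h : G) m n :
  represented_in A g m -> represented_in A h n ->
  represented_in A (g * h)%g (m + n).
Proof.
move=> [s [sA <- <-]] [t [tA <- <-]]; exists (s ++ t).
split; rewrite ?size_cat ?big_cat //.
by move=> a; rewrite mem_cat => /orP[/sA|/tA].
Qed.

Hypothesis genA : generates A.

Lemma represented_in_word_length (g : G) : represented_in A g (word_length A g).
Proof.
rewrite /word_length; case: pselect => [e|]; last by case; exact: genA.
by case: ex_minnP => m /asboolP.
Qed.

Lemma length_function_word_length : length_function (word_length A).
Proof.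
have leV g : (word_length A (g^-1)%g <= word_length A g)%N.
  exact/word_length_le/represented_inV/represented_in_word_length.
split=> [g|g|g h].
- split=> [Lg0|->].
    have [s [_]] := represented_in_word_length g.
    by rewrite Lg0 => /size0nil ->; rewrite big_nil.
  apply/eqP; rewrite -leqn0; apply: word_length_le; exists [::].
  by split; rewrite ?big_nil.
- by apply/eqP; rewrite eqn_leq leV -{1}(invgK g) leV.
- by apply/word_length_le/represented_inM; exact: represented_in_word_length.
Qed.

(** The group is the union over n of the elements represented by words of
length n; each of these sets is finite, because a word of length n + 1 is a
letter followed by a word of length n. *)
Lemma countable_generated : finite_set A -> countable [set: G].
Proof.
move=> finA; pose S := A `|` [set a^-1%g | a in A].
have finS : finite_set S by rewrite finite_setU; split=> //; exact: finite_image.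
have finB n : finite_set [set g | represented_in A g n].
  elim: n => [|n IHn].
    apply: (@sub_finite_set _ _ [set 1%g]) => // g [s [_ /size0nil -> <-]] /=.
    by rewrite big_nil.
  apply: (sub_finite_set _ (finite_image2 (fun a g : G => (a * g)%g) finS IHn)).
  move=> g [[|a s] [// sA [sn] <-]]; rewrite big_cons.
  exists a; last first.
    exists (\prod_(b <- s) b)%g => //; exists s; split=> // b bs.
    by apply: sA; rewrite in_cons bs orbT.
  case: (sA a); rewrite ?mem_head //; first by left.
  by right; exists (a^-1)%g; rewrite ?invgK.
have -> : [set: G] = \bigcup_n [set g | represented_in A g n].
  by apply/esym/seteqP; split=> // g _; have [n gn] := genA g; exists n.
by apply: bigcup_countable => // n _; exact/finite_set_countable/finB.
Qed.

End WordLengthTheory.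

(** * The word metric *)

(** An alias of G that carries the proof of the length axioms, so that the
metric can be attached to this type by inference. *)
Definition length_space (R : realType) (G : groupType) (L : G -> nat)
  (lenL : length_function L) : Type := G.

Section LengthSpace.
Variables (R : realType) (G : groupType) (L : G -> nat).
Hypothesis lenL : length_function L.

Let d (g h : G) : R := (L (g^-1 * h)%g)%:R.

Let dxx g : d g g = 0.
Proof. by case: lenL => L0 _ _; rewrite /d mulVg (L0 1%g).2. Qed.

Let d_eq0 g h : d g h = 0 -> g = h.
Proof.
case: lenL => L0 _ _ /eqP; rewrite pnatr_eq0 => /eqP/L0/mulg1_eq.
by rewrite invgK.
Qed.

Let d_sym g h : d g h = d h g.
Proof. by case: lenL => _ LV _; rewrite /d -LV invgM invgK. Qed.

Let d_triangle h g k : d g k <= d g h + d h k.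
Proof.
case: lenL => _ _ LM; rewrite /d -natrD ler_nat.
by apply: leq_trans (LM _ _); rewrite mulgA mulgK.
Qed.

HB.instance Definition _ := Choice.copy (length_space R lenL) G.
HB.instance Definition _ :=
  isMetric.Build R (length_space R lenL) dxx d_eq0 d_sym d_triangle.

Lemma mdist_length_space (g h : length_space R lenL) :
  mdist g h = (L ((g : G)^-1 * h)%g)%:R.
Proof. by []. Qed.

Definition left_translation (g : G) (x : length_space R lenL) :
  length_space R lenL := (g * (x : G))%g.

Definition origin : length_space R lenL := 1%g : G.

Lemma orbit_length_length_space (g : G) :
  orbit_length left_translation origin g = (L g)%:R.
Proof.
by rewrite /orbit_length mdist_length_space /left_translation mulg1 invg1 mul1g.
Qed.

Lemma isometric_left_translation : isometric_action left_translation.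
Proof.
split=> [x|g h x|g x y]; rewrite /left_translation; first exact: mul1g.
  by rewrite mulgA.
by rewrite !mdist_length_space invgM -mulgA mulKg.
Qed.

Lemma bounded_stabilisers_left_translation :
  bounded_stabilisers left_translation.
Proof.
exists 1%N => x; apply/card_le_realP; exists [:: 1%g] => // g /= gx.
by rewrite inE; apply/eqP/(mulIg (x : G)); rewrite mul1g.
Qed.

End LengthSpace.

(** * Centroids from the CHR property *)

Section Centroids.
Variables (R : realType) (G : groupType) (L : G -> nat).
Hypothesis lenL : length_function L.
Variables (D : set (G * G)) (P1 : {poly R}).
Hypothesis D_fact : D `<=` factorisations L.
Hypothesis P1_nonneg : nonneg_poly P1.
Hypothesis P1_bound : forall r r' : nat,
  (sup_factorisation_number R L D r r' <= (P1.[(minn r r')%:R])%:E)%E.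

(** A left factor of length i leaves a right factor of length L g - i, so each
i <= m is one instance of (D1); its bound depends on min(i, L g - i) <= m.
This serves both for all left factors of g (with m = L g) and for the short
ones that (D2) produces. *)
Lemma card_left_factors (g : G) m :
  card_le_real
    [set x | exists2 y, D (x, y) /\ (x * y)%g = g & (L x <= m)%N]
    (m.+1%:R * P1.[m%:R]).
Proof.
pose F i := [set p : G * G |
  [/\ D p, (p.1 * p.2)%g = g, L p.1 = i & L p.2 = (L g - i)%N]].
apply: (@card_le_real_sub _ _ _ (\bigcup_(i < m.+1) (fst @` F i))).
  move=> x [y [Dxy xyg] xm]; exists (L x) => //; exists (x, y) => //.
  by split=> //=; rewrite -xyg -(D_fact Dxy) addKn.
apply: card_le_real_bigcup => i; rewrite ltnS => im.
apply: card_le_real_image.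
(* Beyond L g the truncated difference is 0, and a factorisation cannot have
   a left factor longer than g. *)
have [ig|gi] := leqP i (L g); last first.
  apply: (@card_le_real_sub _ _ _ set0); last first.
    by apply: card_le_real0; exact: nonneg_poly_ge0.
  by move=> p [/D_fact Lp pg pi _]; move: Lp; rewrite /factorisations /= pg pi; lia.
apply: (@card_le_real_le _ _ _ P1.[(minn i (L g - i))%:R]).
  by apply: nonneg_poly_le => //; rewrite ler_nat; lia.
apply: le_trans (P1_bound _ _); apply: ereal_sup_ubound.
by exists g => //; rewrite /sphere /= subnKC.
Qed.

Variables (U : G -> nat -> nat -> set (G * G * G)) (K : nat).
Variables (P2 P3 : {poly R}).
Hypothesis P2_nonneg : nonneg_poly P2.
Hypothesis P2_bound : forall (k : G) (r r' : nat),
  card_le_real (U k r r') P2.[(minn r r')%:R].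
Hypothesis P3_nonneg : nonneg_poly P3.
Hypothesis P3_bound : forall r r' : nat,
  card_le_real (CHR_T U r r') P3.[(minn r r')%:R].

Variable c : G -> G -> G.
Hypothesis cP : forall g k : G,
  let r := L g in let r' := L (g^-1 * k)%g in
  exists k' f2, U k r r' (c g k, k', f2) /\
    CHR_triple L D (K%:R : R) k g (g^-1 * k)%g r r' (c g k) k' f2.

(** Given i = L g, the triangle inequality puts L (g^-1 k) between L k - i and
L k + i: it is L k + i - j for some j <= 2 i <= 2 n. *)
Lemma card_centroids_left (k : G) n :
  card_le_real [set c g k | g in [set g | (L g <= n)%N]]
    (n.+1%:R * ((2 * n).+1%:R * P2.[n%:R])).
Proof.
have [_ LV LM] := lenL.
pose F i j := (fun t => t.1.1) @` U k i (L k + i - j)%N.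
apply: (@card_le_real_sub _ _ _ (\bigcup_(i < n.+1) \bigcup_(j < (2 * n).+1) F i j)).
  move=> _ [g /= gn <-]; have [k' [f2 [Ugk _]]] := cP g k.
  have := LM g (g^-1 * k)%g; rewrite mulVKg => kle.
  have := LM g^-1%g k; rewrite LV => ge.
  exists (L g); first by rewrite /= ltnS.
  exists (L k + L g - L (g^-1 * k)%g)%N; first by rewrite /=; lia.
  by exists (c g k, k', f2) => //; rewrite subKn // addnC.
apply: card_le_real_bigcup => i im; apply: card_le_real_bigcup => j _.
apply: card_le_real_image; apply: card_le_real_le (P2_bound _ _ _).
by apply: nonneg_poly_le => //; rewrite ler_nat; lia.
Qed.

Lemma card_centroids_right (g : G) :
  card_le_real [set c g k | k in [set: G]] ((L g).+1%:R * P1.[(L g)%:R]).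
Proof.
apply: card_le_real_sub (card_left_factors g (L g)) => _ [k _ <-] /=.
have [k' [f2 [_ [_ [h1 [h2 [_ [Dc Lc cg] _ _ _]]]]]]] := cP g k.
by exists h1 => //; lia.
Qed.

(** From g = f1 h1 one gets g^-1 f1 = h1^-1 = h2 (h1 h2)^-1, a quotient of two
elements that range over sets of polynomial size: h2 among the left factors of h
of length at most K n, and h1 h2 among the middle parts T(i, L h). *)
Lemma card_centroids_translated (h : G) n :
  card_le_real [set (g^-1 * c g (g * h))%g | g in [set g | (L g <= n)%N]]
    (((K * n).+1%:R * P1.[(K * n)%:R]) * (n.+1%:R * P3.[n%:R])).
Proof.
pose T := \bigcup_(i < n.+1) CHR_T U i (L h).
have Tn : card_le_real T (n.+1%:R * P3.[n%:R]).
  apply: card_le_real_bigcup => i im; apply: card_le_real_le (P3_bound _ _).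
  by apply: nonneg_poly_le => //; rewrite ler_nat; lia.
apply: card_le_real_sub
  (card_le_real_image2 (fun x t => x * t^-1)%g (card_left_factors h (K * n)) Tn).
move=> _ [g /= gn <-]; have := cP g (g * h)%g; rewrite mulKg.
move=> [k' [f2 [Ugh [_ [h1 [h2 [kE [_ _ cg] [Dh _ hE] _ Lh2]]]]]]].
rewrite kE in Ugh.
exists h2.
  exists f2 => //; move: Lh2; rewrite -natrM ler_nat => /leq_trans -> //.
  by rewrite leq_mul2l; lia.
exists (h1 * h2)%g.
  by exists (L g); rewrite /= ?ltnS //; exists (g * h)%g, (c g (g * h))%g, f2.
by rewrite invgM mulgA mulgV mul1g -[X in (X^-1 * _)%g]cg invgM mulgVK.
Qed.

(** The bounds of the three counts as polynomials in the radius n: each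
choice of a length contributes a linear factor. *)
Definition left_poly : {poly R} := ('X + 1%:P) * ((2%:P * 'X + 1%:P) * P2).

Definition right_poly : {poly R} := ('X + 1%:P) * P1.

Definition translated_poly : {poly R} :=
  (K%:R%:P * 'X + 1%:P) * (P1 \Po (K%:R%:P * 'X)) * (('X + 1%:P) * P3).

Lemma left_poly_nat n :
  left_poly.[n%:R] = n.+1%:R * ((2 * n).+1%:R * P2.[n%:R]).
Proof. by rewrite /left_poly !hornerE -(natr1 n) -(natr1 (2 * n)) natrM. Qed.

Lemma right_poly_nat n : right_poly.[n%:R] = n.+1%:R * P1.[n%:R].
Proof. by rewrite /right_poly !hornerE -natr1. Qed.

Lemma translated_poly_nat n : translated_poly.[n%:R] =
  ((K * n).+1%:R * P1.[(K * n)%:R]) * (n.+1%:R * P3.[n%:R]).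
Proof.
by rewrite /translated_poly !(hornerE, horner_comp) -(natr1 n) -natr1 natrM.
Qed.

Let nonneg_linear (a : nat) : nonneg_poly (a%:R%:P * 'X + 1%:P : {poly R}).
Proof.
apply: nonneg_polyD; last exact: nonneg_polyC.
by apply: nonneg_polyM; [exact: nonneg_polyC|exact: nonneg_polyX].
Qed.

Let nonneg_X1 : nonneg_poly ('X + 1%:P : {poly R}).
Proof. by apply: nonneg_polyD; [exact: nonneg_polyX|exact: nonneg_polyC]. Qed.

Lemma nonneg_left_poly : nonneg_poly left_poly.
Proof. by apply: nonneg_polyM => //; apply: nonneg_polyM. Qed.

Lemma nonneg_right_poly : nonneg_poly right_poly.
Proof. exact: nonneg_polyM. Qed.

Lemma nonneg_translated_poly : nonneg_poly translated_poly.
Proof.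
apply: nonneg_polyM; apply: nonneg_polyM => //; apply: nonneg_poly_comp => //.
by apply: nonneg_polyM; [exact: nonneg_polyC|exact: nonneg_polyX].
Qed.

Lemma centroid_map_left_translation :
  centroid_map (@left_translation R G L lenL) (origin R lenL) c
    (left_poly + right_poly + translated_poly).
Proof.
have NL := nonneg_left_poly; have NR := nonneg_right_poly.
have NT := nonneg_translated_poly.
(* Lengths are integers, so the real ball of radius r is the ball of radius
   truncn r, and the polynomial bounds are monotone. *)
have card_real_ball (T : choiceType) (f : G -> T) (r : R) (Q : {poly R}) :
    0 < r -> nonneg_poly Q ->
    (forall n, card_le_real [set f g | g in [set g | (L g <= n)%N]] Q.[n%:R]) ->
    card_le_real [set f g | g in [set g | (L g)%:R <= r]] Q.[r].
  move=> /ltW r0 NQ cardf.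
  apply: card_le_real_le (card_le_real_sub _ (cardf (Num.truncn r))).
    by apply: nonneg_poly_le => //; rewrite -truncn_ge_nat.
  by apply: image_subset => g /=; rewrite truncn_ge_nat.
split.
- move=> k r r0; under eq_set do rewrite orbit_length_length_space.
  apply: (@card_le_real_le _ _ _ left_poly.[r]).
    by rewrite !hornerD -addrA lerDl addr_ge0 // nonneg_poly_ge0 // ltW.
  by apply: card_real_ball => // n; rewrite left_poly_nat; exact: card_centroids_left.
- move=> g; rewrite orbit_length_length_space.
  apply: (@card_le_real_le _ _ _ right_poly.[(L g)%:R]).
    by rewrite !hornerD addrAC lerDr addr_ge0 // nonneg_poly_ge0.
  by rewrite right_poly_nat; exact: card_centroids_right.
- move=> h r r0; under eq_set do rewrite orbit_length_length_space.
  apply: (@card_le_real_le _ _ _ translated_poly.[r]).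
    by rewrite !hornerD lerDr addr_ge0 // nonneg_poly_ge0 // ltW.
  apply: card_real_ball => // n; rewrite translated_poly_nat.
  exact: card_centroids_translated.
Qed.

End Centroids.

(** Selecting, for each pair (g, k), one triple that (D2) provides for
k = g (g^-1 k).  The real constant K is rounded up to a natural number, so that
K n can serve as a bound on lengths. *)
Lemma CHR_centroid_points (R : realType) (G : groupType) (L : G -> nat)
    (D : set (G * G)) (U : G -> nat -> nat -> set (G * G * G)) (K : R) :
  (forall (k : G) (r r' : nat) (g1 g2 : G),
     sphere L r g1 -> sphere L r' g2 -> k = (g1 * g2)%g ->
     exists f1 k' f2 : G,
       U k r r' (f1, k', f2) /\ CHR_triple L D K k g1 g2 r r' f1 k' f2) ->
  exists (c : G -> G -> G) (N : nat), forall g k : G,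
    let r := L g in let r' := L (g^-1 * k)%g in
    exists k' f2, U k r r' (c g k, k', f2) /\
      CHR_triple L D (N%:R : R) k g (g^-1 * k)%g r r' (c g k) k' f2.
Proof.
move=> UP; pose N := Num.bound `|K|.
have KN m : K * m%:R <= N%:R * m%:R.
  apply: ler_wpM2r => //; apply: (le_trans (ler_norm K)).
  exact/ltW/archi_boundP.
have cex (p : G * G) : exists f1, exists k' f2,
    U p.2 (L p.1) (L (p.1^-1 * p.2)%g) (f1, k', f2) /\
    CHR_triple L D (N%:R : R) p.2 p.1 (p.1^-1 * p.2)%g
      (L p.1) (L (p.1^-1 * p.2)%g) f1 k' f2.
  have [|||f1 [k' [f2 [Uf [kE [h1 [h2 [hE D1 D2 K1 K2]]]]]]]] :=
    UP p.2 (L p.1) (L (p.1^-1 * p.2)%g) p.1 (p.1^-1 * p.2)%g => //.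
    by rewrite mulVKg.
  exists f1, k', f2; split=> //; split=> //; exists h1, h2.
  by split=> //; exact: le_trans (KN _).
have [c cP] := choice cex.
by exists (fun g k => c (g, k)), N => g k; exact: (cP (g, k)).
Qed.

Theorem theorem3p10 (R : realType) (G : groupType) :
  finitely_generated G -> CHR_property R G -> centroid_property R G.
Proof.
move=> _ [A [[finA genA] [D [D_fact [P1 [P1_nonneg P1_bound]]]]]].
move=> [U [K [/CHR_centroid_points[c [N cP]]]]].
move=> [P2 [P2_nonneg P2_bound]] [P3 [P3_nonneg P3_bound]].
have lenL := length_function_word_length genA.
split; first exact: countable_generated genA finA.
exists (length_space R lenL), (@left_translation R G _ lenL), (origin R lenL), c.
exists (left_poly P2 + right_poly P1 + translated_poly P1 N P3); split.
- exact: isometric_left_translation.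
- exact: bounded_stabilisers_left_translation.
- apply: nonneg_polyD; last exact: nonneg_translated_poly.
  by apply: nonneg_polyD; [exact: nonneg_left_poly|exact: nonneg_right_poly].
- exact: (centroid_map_left_translation lenL D_fact P1_nonneg P1_bound
    P2_nonneg P2_bound P3_nonneg P3_bound cP).
Qed.
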